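(* Let $I$ be a monomial ideal in the polynomial ring $S=K[x_1,\dots,x_n]$ over a field $K$, with minimal set of monomial generators $G(I)=\{u_1,\dots,u_s\}$. Then the following statements are equivalent: (1) $I$ is a Lyubeznik ideal. (2) There exists a total order $\prec$ on $G(I)$ such that for every element $u$ of $G(I)$ and every E-minimal cover $C$ of $u$, $C$ is not preserved (with respect to $\prec$). (3) There exists a total order $\prec$ on $G(I)$ such that for every element $u$ of $G(I)$ and every E-minimal cover $C$ of $u$, there exist $D\subseteq C$ and $v\in G(I)$ with $v\notin D$ such that $D\cup\{v\}$ is an E-minimal cover of $v$ and $\min(\overline{D}\setminus D)\prec\min(D)$.
   Context: For a monomial ideal $I$, $G(I)$ is its minimal set of monomial generators. For $A\subseteq G(I)$, the multidegree $m(A)$ is the least common multiple of the elements of $A$. For $A\subseteq G(I)$, $\overline{A}$ denotes the set of all elements of $G(I)$ that divide $m(A)$. A subset $C\subseteq G(I)$ is a cover of $u\in C$ if $u\mid m(C\setminus\{u\})$. A cover $C$ of $u$ is an E-minimal cover of $u$ if no proper subset of $C$ is a cover of $u$. Let $\prec$ be a total order on $G(I)$. For nonempty $A\subseteq G(I)$, $\min(A)$ is the least element of $A$ under $\prec$. A nonempty set $D\subseteq G(I)$ is broken (under $\prec$) if there is $u\in G(I)$ with $u\mid m(D)$ and $u\prec\min(D)$. A subset $E\subseteq G(I)$ is preserved (under $\prec$) if no nonempty subset of $E$ is broken. The Lyubeznik simplicial complex $L_{(I,\prec)}$ is the simplicial complex on the vertex set $G(I)$ whose faces are the $F\subseteq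 G(I)$ such that for every nonempty $G\subseteq F$, $\min\{u\in G(I): u\mid m(G)\}\in G$. The Lyubeznik resolution of $I$ under $\prec$ is the free resolution $\cdots\to L_2\xrightarrow{\varphi_1}L_1\xrightarrow{\varphi_0}I\to0$, where $L_i$ is the free $S$-module with basis the faces $F\in L_{(I,\prec)}$ with $|F|=i$, $\varphi_0(\{u\})=u$, and for a face $F=\{u_{j_1}\prec\cdots\prec u_{j_i}\}$ with $i\ge2$, $\varphi_{i-1}(F)=\sum_{k=1}^{i}(-1)^{k+1}\frac{m(F)}{m(G_k)}G_k$ with $G_k=F\setminus\{u_{j_k}\}$. It is known that this is a free resolution of $I$. It is minimal if $\varphi_{i-1}(L_i)\subseteq(x_1,\dots,x_n)L_{i-1}$ for all $i\ge2$. The ideal $I$ is called a Lyubeznik ideal if there is a total order on $G(I)$ such that the corresponding Lyubeznik resolution of $I$ is a minimal free resolution.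
   Formalization: A cover C of u is additionally required to have C∖{u} nonempty; this matters only for I = S, where with m(∅)=1 the set {1} would be a preserved E-minimal cover of 1, so that (1) would hold while (2) and (3) fail. *)

(* Defs.v *)
From HB Require Import structures.
From mathcomp Require Import all_boot all_order all_algebra.
From mathcomp Require Import finmap.
From mathcomp Require Export mpoly.

Set Implicit Arguments.
Unset Strict Implicit.
Unset Printing Implicit Defensive.

Import GRing.Theory.
Local Open Scope ring_scope.

(* A monomial is represented by its exponent vector m : 'X_{1..n}, so that    *)
(* (m1 <= m2)%MM is divisibility of monomials, and 'X_[m] is the monomial as  *)
(* a polynomial.  Ideals are arbitrary predicates on {mpoly K[n]}: they may   *)
(* be zero or the whole ring.                                                 *)

Section MonomialIdeals.
Variables (K : fieldType) (n : nat).
Local Notation S := {mpoly K[n]}.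

Definition is_ideal (I : S -> Prop) : Prop :=
  [/\ I 0, forall p q, I p -> I q -> I (p + q)
    & forall a p, I p -> I (a * p)].

Definition ideal_gen (P : S -> Prop) (p : S) : Prop :=
  forall J : S -> Prop, is_ideal J -> (forall q, P q -> J q) -> J p.

Definition generated_by (I : S -> Prop) (M : 'X_{1..n} -> Prop) : Prop :=
  forall p, I p <-> ideal_gen (fun q => exists2 m, M m & q = 'X_[m]) p.

Definition monomial_ideal (I : S -> Prop) : Prop :=
  exists M : 'X_{1..n} -> Prop, generated_by I M.

Definition minimal_generators (I : S -> Prop) (G : {fset 'X_{1..n}}) : Prop :=
  generated_by I (fun m => m \in G) /\
  forall H : {fset 'X_{1..n}}, (H `<` G)%fset ->
    ~ generated_by I (fun m => m \in H).

End MonomialIdeals.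

(* Below, G stands for G(I); a subset of G(I) is a term of type {set G}.      *)

Section Covers.
Variables (n : nat) (G : {fset 'X_{1..n}}).

Definition multideg (A : {set G}) : 'X_{1..n} :=
  \big[@mlcm n/0%MM]_(u in A) val u.

Definition mclosure (A : {set G}) : {set G} :=
  [set u : G | (val u <= multideg A)%MM].

(* The lcm of C \ {u} is only considered when that set is nonempty.  With the *)
(* convention multideg set0 = 0%MM (the monomial 1), this only matters for    *)
(* the monomial u = 1, i.e. for the unit ideal: see is_coverE.                *)
Definition is_cover (u : G) (C : {set G}) : bool :=
  [&& u \in C, C :\ u != set0 & (val u <= multideg (C :\ u))%MM].

Lemma is_coverE (u : G) (C : {set G}) : val u != 0%MM ->
  is_cover u C = (u \in C) && (val u <= multideg (C :\ u))%MM.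
Proof.
move=> u1; rewrite /is_cover; case: (eqVneq (C :\ u) set0) => [->|] //=.
rewrite /multideg big_set0; case: (u \in C) => //=; apply/esym/negbTE.
apply: contra u1 => /mnm_lepP le0; apply/eqP/mnmP => i.
by apply/eqP; rewrite mnm0E -leqn0; have := le0 i; rewrite mnm0E.
Qed.

Definition Eminimal_cover (u : G) (C : {set G}) : bool := minset (is_cover u) C.

Variable lt : rel G.

Definition strict_total_order : Prop :=
  [/\ irreflexive lt, transitive lt & forall u v, u != v -> lt u v || lt v u].

Definition is_min (A : {set G}) (u : G) : bool :=
  (u \in A) && [forall v in A, (v != u) ==> lt u v].

Definition broken (D : {set G}) : bool :=
  (D != set0) &&
  [exists u : G, (val u <= multideg D)%MM &&
     [exists d : G, is_min D d && lt u d]].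

Definition preserved (E : {set G}) : bool :=
  [forall D : {set G}, (D \subset E) && (D != set0) ==> ~~ broken D].

(* When A or B is empty, it has no minimum and min_lt A B is false.           *)
Definition min_lt (A B : {set G}) : Prop :=
  exists a b, [/\ is_min A a, is_min B b & lt a b].

Definition lyubeznik_face (F : {set G}) : bool :=
  [forall A : {set G}, (A \subset F) && (A != set0) ==>
     [exists u in A, is_min (mclosure A) u]].

End Covers.

Section LyubeznikResolution.
Variables (K : fieldType) (n : nat) (G : {fset 'X_{1..n}}) (lt : rel G).
Local Notation S := {mpoly K[n]}.

Definition lface (i : nat) : finType :=
  {F : {set G} | lyubeznik_face lt F && (#|F| == i)}.

(* The codomain is S^o, so that the scalars acting on L i are those of S.     *)
Definition L (i : nat) := {ffun lface i -> S^o}.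

Definition phi0 (z : L 1) : S :=
  \sum_(F : lface 1) z F * 'X_[multideg (val F)].

(* If u is the k-th element of F for lt, then k - 1 elements of F are smaller *)
(* than u, and (-1) ^ (k + 1) = (-1) ^ (k - 1).                               *)
Definition face_sign (F : {set G}) (u : G) : S :=
  (-1) ^+ #|[set v in F | lt v u]|.

Definition phi_basis (i : nat) (F : lface i.+1) : L i :=
  [ffun E : lface i => \sum_(u in val F | val E == val F :\ u)
     face_sign (val F) u * 'X_[(multideg (val F) - multideg (val E))%MM]].

(* The map phi i : L_(i+1) -> L_i is only meant for i >= 1: the resolution    *)
(* ends with phi0 : L_1 -> I.                                                 *)
Definition phi (i : nat) (z : L i.+1) : L i :=
  \sum_(F : lface i.+1) z F *: phi_basis F.

Definition is_free_resolution (I : S -> Prop) : Prop :=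
  [/\ forall p, I p <-> exists z, phi0 z = p,
      forall z : L 1, phi0 z = 0 <-> exists w : L 2, phi w = z
    & forall i, (1 <= i)%N ->
      forall z : L i.+1, phi z = 0 <-> exists w : L i.+2, phi w = z].

Definition is_minimal_resolution : Prop :=
  forall i, (1 <= i)%N -> forall z : L i.+1,
    exists w : 'I_n -> L i, phi z = \sum_(j < n) ('X_j : S) *: w j.

End LyubeznikResolution.

Definition lyubeznik_ideal (K : fieldType) (n : nat)
    (I : {mpoly K[n]} -> Prop) (G : {fset 'X_{1..n}}) : Prop :=
  exists lt : rel G, [/\ strict_total_order lt,
    is_free_resolution lt I & is_minimal_resolution K lt].

(* Main.v *)
Require Import Defs.
From mathcomp Require Import all_boot all_order all_algebra.
From mathcomp Require Import finmap mpoly zify.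

(* Faces of the Lyubeznik complex are exactly the preserved sets, and the     *)
(* resolution is minimal iff m(F \ u) != m(F) for every face F with at least  *)
(* two elements and every u in F, i.e. iff no face is a cover.  The complex   *)
(* is always exact: its strand of multidegree a is the simplicial chain       *)
(* complex of the faces F with m(F) | X^a, a cone over the least generator    *)
(* dividing X^a.  Finally, if D is broken by v, a minimal cover of v inside   *)
(* D :|: [set v] provides the set required by (3), for the same order.        *)

Set Implicit Arguments.
Unset Strict Implicit.
Unset Printing Implicit Defensive.

Import GRing.Theory.

(** All three conditions hold for exactly the same orders, so an order is fixed and they are
    compared directly. Every order gives a free resolution ([lyubeznik_free_resolution]), so
    condition (1) only asks for minimality. The entry of the differential from a face F to F minus u
    is, up to sign, the monomial m(F)/m(F minus u). It is a unit precisely when u divides m(F minus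
    u), so minimality says that no face is a cover ([minimal_resolutionP]). Faces are the preserved
    sets ([preserved_face]) and are closed under subsets, so it suffices to exclude the E-minimal
    covers: this is (2), by [preserved_coverP]. Finally (3) only unfolds what it means for a set not
    to be preserved ([not_preservedP]).

    Exactness ([phi_exact]) is checked in one multidegree at a time, where coning over the least
    available generator is a contracting homotopy ([boundary_cone]). *)

Section Combinatorics.
Variables (n : nat) (G : {fset 'X_{1..n}}).
Implicit Types (A B C D E F : {set G}) (u v w : G) (a : 'X_{1..n}).

(** * Multidegrees as least common multiples *)

Lemma multidegE A i : multideg A i = \max_(u in A) val u i.
Proof.
by apply: (big_morph (fun m : 'X_{1..n} => m i)) => [m m'|]; rewrite ?mnmE.
Qed.

Lemma multideg_leP A a :
  reflect (forall u, u \in A -> (val u <= a)%MM) (multideg A <= a)%MM.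
Proof.
apply: (iffP mnm_lepP) => [le u uA|le i].
  by apply/mnm_lepP => i; apply: leq_trans (le i); rewrite multidegE (bigmax_sup u).
by rewrite multidegE; apply/bigmax_leqP => u /le /mnm_lepP.
Qed.

Lemma le_multideg A u : u \in A -> (val u <= multideg A)%MM.
Proof. by move: u; apply/multideg_leP/lepm_refl. Qed.

Lemma multidegS A B : A \subset B -> (multideg A <= multideg B)%MM.
Proof. by move=> /subsetP AB; apply/multideg_leP => u /AB /le_multideg. Qed.

Lemma multideg0 : multideg (set0 : {set G}) = 0%MM.
Proof. by rewrite /multideg big_set0. Qed.

Lemma multideg1 u : multideg [set u] = val u.
Proof. by apply/mnmP => i; rewrite multidegE big_set1. Qed.

Lemma multidegU1 u A a :
  (multideg (u |: A) <= a)%MM = (val u <= a)%MM && (multideg A <= a)%MM.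
Proof.
apply/multideg_leP/andP => [le|[leu /multideg_leP leA] v /setU1P[->//|/leA//]].
split; first by apply: le; rewrite setU11.
by apply/multideg_leP => v vA; apply: le; rewrite setU1r.
Qed.

Lemma sub_mclosure A : A \subset mclosure A.
Proof. by apply/subsetP => u uA; rewrite inE le_multideg. Qed.

(** * Minima, faces, and broken or preserved sets *)

Variables (lt : rel G) (lt_order : strict_total_order lt).

Lemma lt_irr u : lt u u = false.
Proof. by case: lt_order. Qed.

Lemma lt_asym u v : lt u v -> lt v u = false.
Proof.
case: lt_order => irr tr _ uv; apply/negP => vu.
by have := tr _ _ _ uv vu; rewrite irr.
Qed.

Lemma is_min_in A u : is_min lt A u -> u \in A.
Proof. by case/andP. Qed.

Lemma is_min_lt A u v : is_min lt A u -> v \in A -> v != u -> lt u v.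
Proof. by case/andP => _ /forall_inP/(_ v) h /h /implyP. Qed.

Lemma is_min_nlt A u v : is_min lt A u -> v \in A -> lt v u = false.
Proof.
move=> mu vA; have [->|vu] := eqVneq v u; first exact: lt_irr.
exact/lt_asym/(is_min_lt mu).
Qed.

Lemma ex_is_min A : A != set0 -> exists u, is_min lt A u.
Proof.
(* The minimum is the element of A with the fewest predecessors in G. *)
case/set0Pn => x xA; case: (arg_minnP (fun u => #|[set v | lt v u]|) xA).
move=> u uA least; exists u; apply/andP; split=> //; apply/forall_inP => v vA.
apply/implyP => vu; case: lt_order => irr tr tot.
case/orP: (tot _ _ vu) => // lt_vu; have := least _ vA.
rewrite leqNgt proper_card //; apply/properP; split.
  by apply/subsetP => w; rewrite !inE => /tr; apply.
by exists v; rewrite inE ?irr.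
Qed.

Lemma lyubeznik_faceS E F :
  E \subset F -> lyubeznik_face lt F -> lyubeznik_face lt E.
Proof.
move=> EF /forallP fF; apply/forallP => A; apply/implyP => /andP[AE nA].
by apply: (implyP (fF A)); rewrite (subset_trans AE EF).
Qed.

(** A nonempty A is unbroken exactly when the least generator dividing m(A) lies in A: if it lies
    outside, it precedes min(A) and breaks A. *)
Lemma preserved_face E : preserved lt E = lyubeznik_face lt E.
Proof.
apply/forallP/forallP => hE A; apply/implyP => /andP[AE nA]; last first.
  rewrite /broken nA; apply/existsP => -[w /andP[wA /existsP[d /andP[md ltwd]]]].
  have /implyP := hE A; rewrite AE nA => /(_ isT) /exists_inP[u uA mu].
  have wcl : w \in mclosure A by rewrite inE.
  have := is_min_nlt md uA; have [<-|/(is_min_lt mu wcl) ltuw] := eqVneq w u.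
    by rewrite ltwd.
  by case: lt_order => _ tr _; rewrite (tr _ _ _ ltuw ltwd).
have /set0Pn[x xA] := nA; have ncl : mclosure A != set0.
  by apply/set0Pn; exists x; apply: (subsetP (sub_mclosure A)).
have [u mu] := ex_is_min ncl; apply/exists_inP; exists u => //.
have /implyP := hE A; rewrite AE nA => /(_ isT); apply: contraR => uA.
have [d md] := ex_is_min nA; have dA := is_min_in md.
rewrite /broken nA; apply/existsP; exists u.
have := is_min_in mu; rewrite inE => -> /=; apply/existsP; exists d.
rewrite md (is_min_lt mu) ?(subsetP (sub_mclosure A)) //.
by apply: contraNneq uA => <-.
Qed.

(** A subset avoiding u is already a subset of F. For one containing u, its closure consists of
    divisors of the monomial a, among which u is least. Hence the faces with multidegree dividing a
    form a cone with apex u. *)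
Lemma face_cone F a u : is_min lt [set v : G | (val v <= a)%MM] u ->
  (multideg F <= a)%MM -> lyubeznik_face lt F -> lyubeznik_face lt (u |: F).
Proof.
move=> mu Fa /forallP fF; apply/forallP => A; apply/implyP => /andP[AF nA].
have [uA|uA] := boolP (u \in A); last first.
  apply: (implyP (fF A)); rewrite nA andbT; apply/subsetP => v vA.
  by have := subsetP AF v vA; case/setU1P => // vu; rewrite -vu vA in uA.
apply/exists_inP; exists u => //; rewrite /is_min (subsetP (sub_mclosure A)) //=.
apply/forall_inP => v vA; apply/implyP; apply: (is_min_lt mu); rewrite inE.
rewrite inE in vA; apply: lepm_trans vA _; apply: lepm_trans (multidegS AF) _.
by rewrite multidegU1 Fa; have := is_min_in mu; rewrite inE => ->.
Qed.

Lemma face1 u : (forall v, (val v <= val u)%MM -> v = u) ->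
  lyubeznik_face lt [set u].
Proof.
move=> anti; apply/forallP => A; apply/implyP; rewrite subset1.
case/andP => /orP[] /eqP-> nA; last by rewrite eqxx in nA.
apply/exists_inP; exists u; rewrite ?set11 // /is_min inE multideg1 lepm_refl.
by apply/forall_inP => v; rewrite inE multideg1 => /anti ->; rewrite eqxx.
Qed.

(** If v breaks D, then v lies outside D and D with v added covers v. Shrinking this to an E-minimal
    cover leaves a nonempty B inside D, so min(B) is no smaller than min(D) and v still precedes it.
    Since v lies in the closure of B but not in B, the minimum compared in the last clause is at
    most v. *)
Lemma broken_Eminimal_cover D : broken lt D ->
  exists B v, [/\ B \subset D, v \notin B, Eminimal_cover v (v |: B)
                & min_lt lt (mclosure B :\: B) B].
Proof.
case/andP => nD /existsP[v /andP[vD /existsP[d /andP[md ltvd]]]].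
have vnD : v \notin D by apply: contraL ltvd => /(is_min_nlt md) ->.
have covD : is_cover v (v |: D) by rewrite /is_cover setU11 setU1K ?nD.
have [C minC CD] := minset_exists covD.
have /and3P[vC nCv lev] := minsetp minC.
have sCD : C :\ v \subset D by rewrite subDset.
have vB : v \notin C :\ v by rewrite setD11.
exists (C :\ v), v; split; rewrite // ?setD1K //.
have vcl : v \in mclosure (C :\ v) :\: (C :\ v) by rewrite in_setD vB inE.
have [x mx] : exists x, is_min lt (mclosure (C :\ v) :\: (C :\ v)) x.
  by apply: ex_is_min; apply/set0Pn; exists v.
have [b mb] := ex_is_min nCv; exists x, b; split=> //.
have bD := subsetP sCD b (is_min_in mb).
case: lt_order => _ tr _.
have ltvb : lt v b.
  by have [->//|/(is_min_lt md bD)] := eqVneq b d; apply: tr.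
by have [<-//|/(is_min_lt mx vcl)/tr] := eqVneq v x; apply.
Qed.

Lemma min_lt_broken D : min_lt lt (mclosure D :\: D) D -> broken lt D.
Proof.
case=> x [b [mx mb ltxb]]; apply/andP; split.
  by apply/set0Pn; exists b; exact: is_min_in mb.
apply/existsP; exists x; have := is_min_in mx; rewrite !inE => /andP[_ ->] /=.
by apply/existsP; exists b; rewrite mb.
Qed.

Lemma not_preservedP C : ~ preserved lt C <->
  exists (D : {set G}) (v : G),
    [/\ D \subset C, v \notin D, Eminimal_cover v (v |: D)
      & min_lt lt (mclosure D :\: D) D].
Proof.
split=> [/negP|[D [v [DC _ _ /min_lt_broken bD]]] /forallP/(_ D)].
  rewrite negb_forall => /existsP[D]; rewrite negb_imply negbK => /andP[/andP[DC _] bD].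
  have [B [v [BD vB mB lt_B]]] := broken_Eminimal_cover bD.
  by exists B, v; split=> //; apply: subset_trans BD DC.
by rewrite DC bD; case/andP: bD => ->.
Qed.

(** A face that is a cover contains an E-minimal cover, which is again a face. *)
Lemma preserved_coverP :
  (forall u C, Eminimal_cover u C -> ~ preserved lt C) <->
  (forall u F, lyubeznik_face lt F -> ~~ is_cover u F).
Proof.
split=> [noC u F fF|noF u C /minsetp cC].
  apply/negP => cF; have [C minC CF] := minset_exists cF.
  by apply: (noC u C minC); rewrite preserved_face; apply: lyubeznik_faceS CF fF.
by rewrite preserved_face => /(noF u _)/negP; apply.
Qed.

End Combinatorics.

(** * Simplicial chains, their boundary and the cone homotopy *)

Section SimplicialChains.
Variables (n : nat) (G : {fset 'X_{1..n}}) (R : pzRingType).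
Variables (lt : rel G) (lt_order : strict_total_order lt).
Implicit Types (E F X : {set G}) (u v : G) (f : {set G} -> R).
Local Open Scope ring_scope.

Definition pos u E : nat := #|[set v in E | lt v u]|.

(** A chain is encoded as its coefficient function on all subsets of G. This is the coefficient of E
    in the usual simplicial boundary; [pos u E] equals the position of u in E with u added. *)
Definition boundary f E : R :=
  \sum_(u | u \notin E) (-1) ^+ pos u E * f (u |: E).

Definition cone u f F : R := if u \in F then f (F :\ u) else 0.

Lemma eq_boundary f g E : f =1 g -> boundary f E = boundary g E.
Proof. by move=> fg; apply: eq_bigr => u _; rewrite fg. Qed.

Lemma posU1 u v E : v \notin E -> pos u (v |: E) = (lt v u + pos u E)%N.
Proof.
move=> vE; rewrite /pos; case: (boolP (lt v u)) => [ltvu|ltvu].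
  rewrite (_ : [set w in _ | _] = v |: [set w in E | lt w u]).
    by rewrite cardsU1 !inE (negbTE vE).
  apply/setP => w; rewrite !inE; case: eqVneq => [->|//]; exact/idP.
apply: eq_card => w; rewrite !inE.
by case: eqVneq => [->|//]; rewrite (negbTE ltvu) (negbTE vE).
Qed.

Lemma pos_min X E u : is_min lt X u -> E \subset X -> pos u E = 0%N.
Proof.
move=> mu /subsetP EX; apply: eq_card0 => v; rewrite !inE.
by apply/negP => /andP[/EX vX]; rewrite (is_min_nlt lt_order mu vX).
Qed.

Lemma boundaryK f E : boundary (boundary f) E = 0.
Proof.
pose a p := (-1) ^+ (pos p.1 E + pos p.2 (p.1 |: E)) * f (p.2 |: (p.1 |: E)).
pose P p := (p.1 \notin E) && (p.2 \notin p.1 |: E).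
have -> : boundary (boundary f) E = \sum_(p | P p) a p.
  rewrite /boundary; under eq_bigr do rewrite mulr_sumr.
  by rewrite pair_big_dep; apply: eq_bigr => p _; rewrite mulrA -exprD.
have PE p : P p = [&& p.1 \notin E, p.2 \notin E & p.2 != p.1].
  by rewrite /P in_setU1 negb_or andbCA andbC -!andbA andbA andbAC -andbA.
have swapK : {on [pred p | P p && ~~ lt p.1 p.2], bijective
                (fun p : G * G => (p.2, p.1))}.
  by exists (fun p => (p.2, p.1)) => -[].
(* The two orders of adding u and v to E contribute opposite signs, so swapping the pair cancels the
   sum. *)
rewrite (bigID (fun p => lt p.1 p.2)) /= [X in _ + X](reindex _ swapK) /=.
have [_ _ tot] := lt_order.
rewrite [X in _ + X](eq_bigl (fun p => P p && lt p.1 p.2)); last first.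
  move=> [u v]; rewrite !PE /= eq_sym andbCA -andbA -andbA -!andbA.
  congr [&& _, _ & _]; have [->|uv] := eqVneq u v; first by rewrite lt_irr.
  case/orP: (tot _ _ uv) => /= ltuv; rewrite ltuv (lt_asym lt_order ltuv) //.
rewrite -big_split big1 //= => -[u v] /andP[]; rewrite PE => /and3P[/= uE vE vu] ltuv.
rewrite /a /= !posU1 // ltuv (lt_asym lt_order ltuv) setUCA -mulrDl.
by rewrite add0n addnCA exprS addnC mulN1r addNr mul0r.
Qed.

(* cone u is a contracting homotopy: as u is least, it has sign +1 in every   *)
(* face, and removing it flips the sign of every other element.               *)
Lemma boundary_cone X u f E : is_min lt X u ->
    (forall F, ~~ (F \subset X) -> f F = 0) ->
  boundary (cone u f) E + cone u (boundary f) E = f E.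
Proof.
move=> mu f0; have uX := is_min_in mu.
(* Either F' lies in X, where u has nothing below it, or f vanishes at F'. *)
have sgn F F' : F \subset F' -> (-1) ^+ pos u F * f F' = f F'.
  move=> FF'; have [FX|/f0->] := boolP (F' \subset X); last by rewrite mulr0.
  by rewrite (pos_min mu (subset_trans FF' FX)) mul1r.
rewrite /cone; have [uE|uE] := boolP (u \in E); last first.
  rewrite addr0 /boundary (bigD1 u) //= big1 ?addr0 => [|v /andP[vE vu]].
    by rewrite setU11 setU1K ?sgn.
  by rewrite in_setU1 (negbTE uE) eq_sym (negbTE vu) mulr0.
(* When u is in E, re-adding u to E minus u gives back f E. The other terms of the two sums cancel
   in pairs, since removing u lowers the position of each v above it by one. *)
rewrite /boundary addrC (bigD1 u) ?setD11 //= setD1K // -addrA.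
have posD v : v != u -> pos v E = (lt u v + pos v (E :\ u))%N.
  by move=> vu; rewrite -{1}(setD1K uE) posU1 // setD11.
rewrite sgn ?subD1set // (eq_bigl (fun v => v \notin E)) => [|v]; last first.
  rewrite in_setD1 negb_and negbK; have [->|] := eqVneq v u; last by rewrite andbT.
  by rewrite uE.
rewrite -big_split big1 ?addr0 //= => v vE.
have vu : v != u by apply: contraNneq vE => ->.
have -> : (v |: E) :\ u = v |: E :\ u.
  by rewrite setDUl; congr (_ :|: _); apply/setDidPl; rewrite disjoints1 inE.
rewrite in_setU1 uE orbT posD //.
have [vX|vX] := boolP (v \in X).
  by rewrite (is_min_lt mu vX vu) exprS mulN1r mulNr addrN.
rewrite f0 ?mulr0 ?addr0 //; apply: contra vX => /subsetP; apply.
exact: setU11.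
Qed.

End SimplicialChains.

(** * Decomposition into multigraded strands, and exactness *)

Section Strands.
Variables (K : fieldType) (n : nat) (G : {fset 'X_{1..n}}) (lt : rel G).
Hypothesis lt_order : strict_total_order lt.
Implicit Types (E F : {set G}) (u v : G) (a : 'X_{1..n}) (i : nat).
Local Open Scope ring_scope.
Local Notation S := {mpoly K[n]}.
Local Notation L := (L K lt).

(** Extension by zero from the faces of size i to all subsets, so that sums can range over G without
    subtypes. *)
Definition coord i (z : L i) F : S := oapp z 0 (insub F).

(* The value at F of the component of multidegree a of z: the basis element F *)
(* has multidegree m(F).                                                      *)
Definition strand i (z : L i) a F : K :=
  if (multideg F <= a)%MM then (coord z F)@_(a - multideg F) else 0.

Lemma coordE i (z : L i) (F : lface lt i) : coord z (val F) = z F.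
Proof. by rewrite /coord valK. Qed.

Lemma coord_out i (z : L i) F :
  ~~ (lyubeznik_face lt F && (#|F| == i)) -> coord z F = 0.
Proof. by move=> nF; rewrite /coord insubN. Qed.

Lemma strand_face i (z : L i) a F : strand z a F != 0 ->
  [/\ lyubeznik_face lt F, #|F| = i & (multideg F <= a)%MM].
Proof.
rewrite /strand; case: ifP => [le nz|]; last by rewrite eqxx.
have [/andP[fF /eqP cF] //|/(coord_out z) z0] :=
  boolP (lyubeznik_face lt F && (#|F| == i)).
by rewrite z0 mcoeff0 eqxx in nz.
Qed.

Lemma phiE i (z : L i.+1) (E : lface lt i) :
  phi z E = \sum_(F : lface lt i.+1) \sum_(u in val F | val E == val F :\ u)
    z F * (face_sign K lt (val F) u * 'X_[multideg (val F) - multideg (val E)]).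
Proof.
rewrite /phi sum_ffunE; apply: eq_bigr => F _; rewrite ffunE.
by rewrite /phi_basis ffunE; apply: mulr_sumr.
Qed.

Lemma face_sign_pos u E : u \notin E -> face_sign K lt (u |: E) u = (-1) ^+ pos lt u E.
Proof.
(* The 0 is recast as the truth value of [lt u u], to fit [posU1]: u does not count itself. *)
move=> uE; rewrite -[pos _ _ _]add0n -[0%N]/(nat_of_bool false).
by rewrite -(lt_irr lt_order u) -posU1.
Qed.

Lemma coord_phi i (z : L i.+1) E :
  coord (phi z) E = \sum_(u | u \notin E)
    (-1) ^+ pos lt u E * ('X_[multideg (u |: E) - multideg E] * coord z (u |: E)).
Proof.
have cardU u : u \notin E -> (#|u |: E| == i.+1) = (#|E| == i).
  by move=> uE; rewrite cardsU1 uE.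
have [PE|nPE] := boolP (lyubeznik_face lt E && (#|E| == i)); last first.
  rewrite coord_out // big1 // => u uE; rewrite coord_out ?mulr0 // cardU //.
  by apply: contra nPE => /andP[/(lyubeznik_faceS (subsetUr _ _))-> ->].
rewrite /coord insubT /= phiE.
(* Summing over u first leaves at most one face for each u, namely E with u added. *)
rewrite (exchange_big_dep (fun u => u \notin E)) /=; last first.
  by move=> F u _ /andP[_ /eqP->]; rewrite setD11.
apply: eq_bigr => u uE.
have memP (F : lface lt i.+1) :
    (u \in val F) && (E == val F :\ u) = (val F == u |: E).
  apply/andP/eqP => [[uF /eqP->]|->]; first by rewrite setD1K.
  by rewrite setU11 setU1K.
rewrite (eq_bigl _ _ memP); case: insubP => [F _ vF|nF] /=; last first.
  rewrite big_pred0 ?mulr0 // => F; apply: contraNF nF => /eqP<-.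
  exact: valP F.
rewrite (big_pred1 F) => [|F']; last by rewrite /= -vF.
by rewrite vF face_sign_pos // mulrC mulrA.
Qed.

Lemma mcoeffXM (m k : 'X_{1..n}) (p : S) :
  ('X_[m] * p)@_k = if (m <= k)%MM then p@_(k - m) else 0.
Proof.
case: ifP => [le|nle]; first by rewrite -{1}(submK le) addmC -commr_mpolyX mcoeffMX.
apply/eqP; rewrite mcoeff_eq0; apply/negP => /msuppM_le.
case/allpairsP => -[m1 m2] /= [+ _ km]; rewrite msuppX inE => /eqP m1E.
by rewrite km m1E lem_addr in nle.
Qed.

Lemma mcoeff_signM k (p : S) (m : 'X_{1..n}) :
  ((-1) ^+ k * p)@_m = (-1) ^+ k * p@_m.
Proof.
by elim: k => [|k IH]; rewrite ?expr0 ?mul1r // !exprS !mulN1r !mulNr mcoeffN IH.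
Qed.

(** The monomial coefficients of [phi] exactly compensate the shift by m(F) in [strand], so in a
    fixed multidegree only the simplicial signs remain. *)
Lemma strand_phi i (z : L i.+1) a E :
  strand (phi z) a E = boundary lt (strand z a) E.
Proof.
rewrite /strand /boundary; case: ifP => [le|nle]; last first.
  by rewrite big1 // => u _; rewrite multidegU1 nle andbF mulr0.
rewrite coord_phi raddf_sum; apply: eq_bigr => u uE.
have leU := multidegS (subsetUr [set u] E).
rewrite [LHS]mcoeff_signM mcoeffXM; congr (_ * _).
have -> : (multideg (u |: E) - multideg E <= a - multideg E)%MM =
          (multideg (u |: E) <= a)%MM.
  apply/mnm_lepP/mnm_lepP => h j; have := h j; have := mnm_lepP le j;
  by have := mnm_lepP leU j; rewrite !mnmE; lia.
case: ifP => // leUa; congr (_@__); apply/mnmP => j.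
by have := mnm_lepP leUa j; have := mnm_lepP leU j; rewrite !mnmE; lia.
Qed.

Lemma strand_inj i (z z' : L i) :
  (forall a F, strand z a F = strand z' a F) -> z = z'.
Proof.
move=> eq_zz'; apply/ffunP => F; apply/mpolyP => m.
have := eq_zz' (m + multideg (val F))%MM (val F).
by rewrite /strand lem_addl addmK !coordE.
Qed.

Lemma strand0 i a F : strand (0 : L i) a F = 0.
Proof.
rewrite /strand /coord; case: ifP => // _.
by case: insub => [F'|] /=; rewrite ?ffunE mcoeff0.
Qed.

(** Strands built from those of z are nonzero in boundedly many degrees only, so that [ex_strand]
    can reassemble them into polynomials. *)
Lemma strand_bound i (z : L i) :
  exists k, forall a F, strand z a F != 0 -> (mdeg a < k)%N.
Proof.
exists (\max_(F : lface lt i) (msize (z F) + mdeg (multideg (val F)))).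
move=> a F nz; have [fF /eqP cF le] := strand_face nz; move: nz.
have PF : lyubeznik_face lt F && (#|F| == i) by rewrite fF cF.
rewrite /strand le -[F]/(val (Sub F PF : lface lt i)) coordE -mcoeff_msupp.
move=> /msize_mdeg_lt lt_a; apply: (bigmax_sup (Sub F PF)) => //.
by rewrite -{1}(submK le) mdegD -addSn leq_add2r.
Qed.

Lemma ex_strand i (g : 'X_{1..n} -> {set G} -> K) k :
    (forall a F, g a F != 0 -> [/\ lyubeznik_face lt F, #|F| = i,
       (multideg F <= a)%MM & (mdeg a < k)%N]) ->
  exists w : L i, forall a F, strand w a F = g a F.
Proof.
move=> gP; exists [ffun F : lface lt i => \sum_(a : 'X_{1..n < k}
  | (multideg (val F) <= a)%MM) g a (val F) *: 'X_[a - multideg (val F)]].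
move=> a F; have [g0|/gP[fF /eqP cF le lt_ak]] := eqVneq (g a F) 0; last first.
  have PF : lyubeznik_face lt F && (#|F| == i) by rewrite fF cF.
  rewrite /strand le -[F]/(val (Sub F PF : lface lt i)) coordE ffunE /= raddf_sum.
  rewrite (bigD1 (BMultinom lt_ak)) //= mcoeffZ mcoeffX eqxx mulr1 big1 ?addr0 //.
  move=> b /andP[leb]; rewrite bmeqP /= => ba; rewrite mcoeffZ mcoeffX.
  case: eqP => [/(congr1 (fun m => m + multideg F)%MM)|]; last by rewrite mulr0.
  by rewrite !submK // => /eqP; rewrite (negbTE ba).
rewrite g0 /strand; case: ifP => // le; rewrite /coord.
case: insubP => [F' _ vF|_] /=; last by rewrite mcoeff0.
rewrite ffunE vF raddf_sum big1 //= => b leb; rewrite mcoeffZ mcoeffX.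
case: eqP => [/(congr1 (fun m => m + multideg F)%MM)|]; last by rewrite mulr0.
by rewrite !submK // => ->; rewrite g0 mul0r.
Qed.

(** In multidegree a, a cycle is the boundary of its cone over the least generator dividing a. The
    index i = 0 is included and yields exactness at L_1. *)
Lemma phi_exact i (z : L i.+1) : phi z = 0 <-> exists w : L i.+2, phi w = z.
Proof.
split=> [dz|[w <-]]; last first.
  apply: strand_inj => a F; rewrite strand_phi strand0.
  rewrite -[RHS](boundaryK lt_order (strand w a) F).
  exact/eq_boundary/strand_phi.
pose below a := [set v : G | (val v <= a)%MM].
have below_min a F : strand z a F != 0 -> exists u, is_min lt (below a) u.
  case/strand_face => _ cF le; apply: (ex_is_min lt_order).
  have /card_gt0P[v vF] : (0 < #|F|)%N by rewrite cF.
  by apply/set0Pn; exists v; rewrite inE (lepm_trans (le_multideg vF) le).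
(* If no generator divides a, the strand of z vanishes, because its faces are nonempty; the default
   0 is then correct. *)
pose g a F :=
  if [pick u | is_min lt (below a) u] is Some u then cone u (strand z a) F else 0.
have [k bound] := strand_bound z.
have gP a F : g a F != 0 -> [/\ lyubeznik_face lt F, #|F| = i.+2,
    (multideg F <= a)%MM & (mdeg a < k)%N].
  rewrite /g; case: pickP => [u mu|]; last by rewrite eqxx.
  rewrite /cone; case: ifP => [uF nz|]; last by rewrite eqxx.
  have [fF cF le] := strand_face nz; rewrite -(setD1K uF); split.
  - exact: face_cone mu le fF.
  - by rewrite cardsU1 setD11 cF.
  - by rewrite multidegU1 le andbT; have := is_min_in mu; rewrite inE.
  - exact: bound nz.
have [w wE] := ex_strand gP; exists w; apply: strand_inj => a E.
rewrite strand_phi (eq_boundary _ _ (wE a)) /g.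
case: pickP => [u mu|none]; last first.
  rewrite /boundary big1 => [|u _]; last by rewrite mulr0.
  by apply/esym/eqP; apply: contraT => /below_min[u]; rewrite none.
rewrite -[RHS](boundary_cone lt_order _ mu (f := strand z a)) => [|F].
  by rewrite [cone _ (boundary _ _) _]/cone -strand_phi dz strand0 if_same addr0.
apply: contraNeq => /strand_face[_ _ /multideg_leP le].
by apply/subsetP => v /le; rewrite inE.
Qed.

Lemma lface0 (E : lface lt 0) : val E = set0.
Proof. by have /andP[_] := valP E; rewrite cards_eq0 => /eqP. Qed.

(** The module L_0 is free on the empty face, of multidegree 1, which makes the augmentation one
    more instance of [phi]. *)
Lemma phi0E (z : L 1) (E : lface lt 0) : phi z E = phi0 z.
Proof.
rewrite phiE; apply: eq_bigr => F _; rewrite lface0.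
have /andP[_ /cards1P[x ->]] := valP F; rewrite (big_pred1 x) => [|u].
  rewrite multideg0 subm0 /face_sign (_ : [set v in _ | _] = set0) ?cards0 ?mul1r //.
  by apply/setP => v; rewrite !inE; case: eqP => // ->; rewrite (lt_irr lt_order).
by rewrite inE /=; have [->|] := eqVneq u x; rewrite ?setDv ?eqxx.
Qed.

Lemma phi0_eq0 (z : L 1) : phi0 z = 0 <-> phi z = 0.
Proof.
have f0 : lyubeznik_face lt set0 && (#|set0 : {set G}| == 0%N).
  rewrite cards0 andbT; apply/forallP => A; apply/implyP.
  by rewrite subset0 => /andP[->].
split=> [z0|]; first by apply/ffunP => E; rewrite phi0E ffunE.
by rewrite -(phi0E z (Sub set0 f0 : lface lt 0)) => ->; rewrite ffunE.
Qed.

End Strands.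

(** * Minimality read off from constant terms *)

Section Minimality.
Variables (K : fieldType) (n : nat) (G : {fset 'X_{1..n}}) (lt : rel G).
Hypothesis lt_order : strict_total_order lt.
Implicit Types (E F : {set G}) (u v : G) (i : nat) (m : 'X_{1..n}).
Local Open Scope ring_scope.
Local Notation S := {mpoly K[n]}.

Lemma lem0 m : (m <= 0)%MM = (m == 0%MM).
Proof.
apply/mnm_lepP/eqP => [le0|-> //]; apply/mnmP => j.
by have := le0 j; rewrite mnm0E leqn0 => /eqP.
Qed.

(** Each monomial of p differs from 1 and is assigned to one chosen variable dividing it. *)
Lemma irrelevant_idealE (p : S) : p@_0 = 0 ->
  p = \sum_(j < n) 'X_j *
    \sum_(m <- msupp p | [pick k | m k != 0%N] == Some j) p@_m *: 'X_[m - U_(j)].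
Proof.
move=> p0; under eq_bigr do rewrite mulr_sumr.
rewrite (exchange_big_dep xpredT) //= [LHS]mpolyE.
rewrite big_seq [RHS]big_seq; apply: eq_bigr => m; rewrite mcoeff_msupp => pm.
case: pickP => [j mj|m0]; last first.
  suff m_0 : m = 0%MM by rewrite m_0 p0 eqxx in pm.
  by apply/mnmP => j; rewrite mnm0E; apply/eqP/negbFE/m0.
rewrite (big_pred1 j) => [|k]; last by rewrite /= eq_sym.
by rewrite -scalerAr -mpolyXD addmC submK ?lep1mP.
Qed.

Lemma minimal_resolutionP : is_minimal_resolution K lt <->
  (forall u F, lyubeznik_face lt F -> ~~ is_cover u F).
Proof.
split=> [minL u F fF|noF [//|i] _ z].
  apply/negP => /and3P[uF nFu le]; pose E := F :\ u.
  have uE : u \notin E by rewrite setD11.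
  have FE : F = u |: E by rewrite setD1K.
  case cE: #|E| => [|i]; first by move/eqP: cE; rewrite cards_eq0 (negbTE nFu).
  have PF : lyubeznik_face lt F && (#|F| == i.+2) by rewrite fF FE cardsU1 uE cE eqxx.
  have PE : lyubeznik_face lt E && (#|E| == i.+1).
    by rewrite cE eqxx (lyubeznik_faceS (subD1set _ _) fF).
  (* The basis vector of F: the E-entry of its image has constant term 0 by minimality, yet it is a
     sign because m(F) = m(E). *)
  pose z : L K lt i.+2 := [ffun F' => (val F' == F)%:R].
  have [w wP] := minL i.+1 isT z.
  have : (coord (phi z) E)@_0 = 0.
    rewrite wP -[E]/(val (Sub E PE : lface lt i.+1)) coordE sum_ffunE raddf_sum.
    rewrite big1 // => j _; rewrite ffunE [LHS]mcoeffXM lem0.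
    by case: eqP => // /mnmP/(_ j); rewrite mnm1E mnm0E eqxx.
  rewrite (coord_phi lt_order) (bigD1 u) //= big1 => [|v /andP[vE vu]]; last first.
    rewrite /coord; case: insubP => [F' _ vF'|] /=; last by rewrite !mulr0.
    rewrite ffunE vF'; case: eqP => [FE'|]; last by rewrite !mulr0.
    have : v \in F by rewrite -FE' setU11.
    by rewrite FE in_setU1 (negbTE vu) (negbTE vE).
  rewrite addr0 -FE -{2}[F]/(val (Sub F PF : lface lt i.+2)) coordE ffunE eqxx mulr1.
  rewrite mcoeff_signM mcoeffX (_ : (_ - _)%MM = 0%MM) ?eqxx ?mulr1.
    by move/eqP; rewrite signr_eq0.
  apply/mnmP => j; rewrite mnmBE mnm0E; apply/eqP; rewrite subn_eq0.
  move: j; apply/mnm_lepP.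
  by rewrite {1}FE multidegU1 le lepm_refl.
(* A nonzero constant term would need m(E) unchanged by adding some u with E and u together a face,
   and that face would cover u; E is nonempty by its cardinality. *)
have c0 (E : lface lt i.+1) : (phi z E)@_0 = 0.
  rewrite -coordE (coord_phi lt_order) raddf_sum big1 // => u uE.
  rewrite [LHS]mcoeff_signM mcoeffXM lem0; case: eqP => [d0|]; last by rewrite mulr0.
  have [/andP[fU _]|nf] :=
    boolP (lyubeznik_face lt (u |: val E) && (#|u |: val E| == i.+2));
    last by rewrite coord_out // mcoeff0 mulr0.
  have /negP[] := noF u _ fU; rewrite /is_cover setU11 setU1K //=; apply/andP; split.
    by have /andP[_ /eqP cE] := valP E; rewrite -card_gt0 cE.
  apply: lepm_trans (le_multideg (setU11 u (val E))) _.
  apply/mnm_lepP => j; have /mnmP/(_ j)/eqP := d0.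
  by rewrite mnmBE mnm0E subn_eq0.
exists (fun j => [ffun E => \sum_(m <- msupp (phi z E) |
  [pick k | m k != 0%N] == Some j) (phi z E)@_m *: 'X_[m - U_(j)]]).
apply/ffunP => E; rewrite [LHS](irrelevant_idealE (c0 E)) [RHS]sum_ffunE.
by apply: eq_bigr => j _; rewrite !ffunE.
Qed.

End Minimality.

(** * Minimal generators and the augmentation onto the ideal *)

Section Generators.
Variables (K : fieldType) (n : nat) (G : {fset 'X_{1..n}}).
Implicit Types (I J : {mpoly K[n]} -> Prop) (u v : G).
Local Open Scope ring_scope.

Lemma ideal_gen_ideal (P : {mpoly K[n]} -> Prop) : is_ideal (ideal_gen P).
Proof.
split=> [J [] //|p q Ip Iq J idJ PJ|b p Ip J idJ PJ]; have [_ JD JM] := idJ.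
  by apply: JD; [apply: Ip | apply: Iq].
by apply: JM; apply: Ip.
Qed.

Lemma ideal_sum I (T : finType) (f : T -> {mpoly K[n]}) :
  is_ideal I -> (forall x, I (f x)) -> I (\sum_x f x).
Proof. by case=> I0 ID _ If; apply: big_ind. Qed.

(** If u properly divided v, then v could be dropped from the generating set. *)
Lemma minimal_generators_antichain I : minimal_generators I G ->
  forall u v, (val u <= val v)%MM -> u = v.
Proof.
case=> gG minG u v le; apply/eqP; apply: contraT => uv.
have vG : val v \in G := valP v.
case: (minG (G `\ val v)%fset); first exact: fproperD1.
move=> p; split=> [/gG Gp J idJ HJ|Hp].
  apply: Gp => // _ [m mG ->]; have [->|mv] := eqVneq m (val v).
    rewrite -(submK le) mpolyXD; case: idJ => _ _; apply; apply: HJ.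
    by exists (val u); rewrite // !inE (valP u) (inj_eq val_inj) uv.
  by apply: HJ; exists m; rewrite // !inE mv.
apply/gG => J idJ GJ; apply: Hp => // _ [m /[!inE] /andP[_ mG] ->].
by apply: GJ; exists m.
Qed.

Lemma lyubeznik_free_resolution I (lt : rel G) : strict_total_order lt ->
  minimal_generators I G -> is_free_resolution lt I.
Proof.
move=> lt_order hG; have anti := minimal_generators_antichain hG.
have [gG _] := hG; split=> [p|z|i _ z]; last 2 first.
- by rewrite phi0_eq0 //; apply: phi_exact.
- exact: phi_exact.
split=> [/gG|[z <-]]; last first.
  apply/gG; have idG := ideal_gen_ideal (fun q => exists2 m, m \in G & q = 'X_[m]).
  apply: ideal_sum => // F; case: (idG) => _ _; apply=> J _; apply.
  have /andP[_ /cards1P[x ->]] := valP F; exists (val x); first exact: valP.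
  by rewrite multideg1.
(* The image of [phi0] is an ideal containing every generator, since the antichain property makes
   each singleton a face. *)
move/(_ (fun q => exists z : L K lt 1, phi0 z = q)); apply=> [|_ [m mG ->]].
  split=> [|_ _ [z <-] [z' <-]|b _ [z <-]].
  - by exists 0; rewrite /phi0 big1 // => F _; rewrite ffunE mul0r.
  - exists (z + z'); rewrite /phi0 -big_split; apply: eq_bigr => F _.
    by rewrite ffunE mulrDl.
  - exists (b *: z); rewrite /phi0 mulr_sumr; apply: eq_bigr => F _.
    by rewrite ffunE mulrA.
pose u : G := [` mG]%fset.
have PF : lyubeznik_face lt [set u] && (#|[set u]| == 1%N).
  by rewrite cards1 eqxx face1 // => v; apply: anti.
pose F0 : lface lt 1 := Sub [set u] PF.
exists [ffun F => (F == F0)%:R]; rewrite /phi0 (bigD1 F0) //= big1.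
  by rewrite ffunE eqxx mul1r addr0 multideg1.
by move=> F; rewrite ffunE => /negbTE->; rewrite mul0r.
Qed.

End Generators.

Theorem theorem3p1 (K : fieldType) (n : nat) (I : {mpoly K[n]} -> Prop)
    (G : {fset 'X_{1..n}}) (hI : monomial_ideal I)
    (hG : minimal_generators I G) :
  let cond1 := lyubeznik_ideal I G in
  let cond2 := exists lt : rel G, strict_total_order lt /\
    forall (u : G) (C : {set G}), Eminimal_cover u C -> ~ preserved lt C in
  let cond3 := exists lt : rel G, strict_total_order lt /\
    forall (u : G) (C : {set G}), Eminimal_cover u C ->
      exists (D : {set G}) (v : G),
        [/\ D \subset C, v \notin D, Eminimal_cover v (v |: D)
          & min_lt lt (mclosure D :\: D) D] in
  (cond1 <-> cond2) /\ (cond2 <-> cond3).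
Proof.
split; split=> -[lt].
- case=> lt_order _ /(minimal_resolutionP K lt_order) noF; exists lt.
  by split=> //; apply/preserved_coverP.
- case=> lt_order /(preserved_coverP lt_order) noF; exists lt.
  split=> //; first exact: lyubeznik_free_resolution.
  exact/minimal_resolutionP.
- case=> lt_order noC; exists lt; split=> // u C /noC.
  by move/not_preservedP; apply.
- case=> lt_order noC; exists lt; split=> // u C /noC.
  by move/not_preservedP; apply.
Qed.
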